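(* Let $\mathcal T$ be a CStree with $p=3$. Then $\mathcal T$ is balanced (i.e. $\mathcal M(\mathcal T)$ is a decomposable CSmodel) if and only if all minimal context DAGs of $\mathcal T$ are perfect.
   Context: Notation. $[p]=\{1,\dots,p\}$; $X_1,\dots,X_p$ are discrete random variables, $X_i$ with state space $[d_i]=\{1,\dots,d_i\}$. For $A\subseteq[p]$ let $\mathcal R_A=\prod_{i\in A}[d_i]$, $\mathcal R=\mathcal R_{[p]}$. For $\mathbf x\in\mathcal R_B$ and $A\subseteq B$, $\mathbf x_A=(x_i)_{i\in A}$; for disjoint $A,B$, $\mathbf x_A\mathbf x_B\in\mathcal R_{A\cup B}$ is the combined outcome. CStrees. Let $\mathcal T=(V,E)$ be the rooted tree with $V=\{\mathrm{root}\}\cup\bigcup_{j\in[p]}\mathcal R_{[j]}$ and edges $\mathrm{root}\to x_1$ and $x_1\cdots x_{k-1}\to x_1\cdots x_k$. Its $k$-th level is $L_k=\mathcal R_{[k]}$ ($L_0=\{\mathrm{root}\}$); $E(v)$ is the set of outgoing edges of $v$. A labeling $\theta:E\to\mathcal L$ ($\mathcal L$ a finite set) makes $\mathcal T$ a staged tree if $|\theta(E(v))|=|E(v)|$ for all $v$, and $\theta(E(v)),\theta(E(w))$ are equal or disjoint for all $v,w$. Non-leaf vertices $v,w$ are in the same stage iff $\theta(E(v))=\theta(E(w))$; the equivalence classes are the stages (leaves are regarded as singleton stages). A staged tree is a CStree if: (1) $\theta(E(v))\ne\theta(E(w))$ for non-leaf $v,w$ in different levels; (2) $\theta(x_1\cdots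 x_{k-1}\to x_1\cdots x_{k-1}x_k)=\theta(y_1\cdots y_{k-1}\to y_1\cdots y_{k-1}x_k)$ whenever $x_1\cdots x_{k-1}$ and $y_1\cdots y_{k-1}$ are in the same stage; (3) for every $k\in[p]$ and every stage $S\subseteq L_{k-1}$ there are $C\subseteq[k-1]$ and $\mathbf x_C\in\mathcal R_C$ with $S=\{\mathbf x_C\mathbf y:\mathbf y\in\mathcal R_{[k-1]\setminus C}\}$. Balanced. For $v\in L_{k-1}$ let $t(v)=\sum_{\mathbf z\in\mathcal R_{[p]\setminus[k-1]}}\prod_{e\in E(v\to v\mathbf z)}\theta(e)$ in the polynomial ring $\mathbb R[\theta(e):e\in E]$ whose variables are the labels ($E(v\to v\mathbf z)$: edges on the path from $v$ to $v\mathbf z$). $\mathcal T$ is balanced if for every $k\in[p]$, all $v,w\in L_{k-1}$ in the same stage and all $s,r\in[d_k]$: $t(vs)t(wr)=t(vr)t(ws)$ in this ring. A decomposable CSmodel is the statistical model $\mathcal M(\mathcal T)$ of a balanced CStree $\mathcal T$ (the set of distributions $f(\mathbf x)=\prod_{e\in E(\mathrm{root}\to\mathbf x)}x_{\theta(e)}$ with $x_{\theta(e)}\in(0,1)$ and $\sum_{e\in E(v)}x_{\theta(e)}=1$ for each non-leaf $v$). CSI statements and $\mathcal J(\mathcal T)$. A CSI statement is written $X_A\perp X_B\mid X_S,X_C=\mathbf x_C$ with $A,B,S,C\subseteq[p]$ pairwise disjoint and $\mathbf x_C\in\mathcal R_C$ (trivial if $A$ or $B$ is empty); if $C=\emptyset$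 it is a CI statement. For a stage $S\subseteq L_{k-1}$ let $C\subseteq[k-1]$ be the set of indices at which all elements of $S$ agree and $\mathbf x_C$ the common value; the stage statement is $X_k\perp X_{[k-1]\setminus C}\mid X_C=\mathbf x_C$. $\mathcal J(\mathcal T)$ is the set of all CSI statements derivable from the stage statements by the CSI axioms (all index sets disjoint; $A\perp B|S,\mathbf x_C$ abbreviates $X_A\perp X_B|X_S,X_C=\mathbf x_C$): symmetry: $A\perp B|S,\mathbf x_C\Rightarrow B\perp A|S,\mathbf x_C$; decomposition: $A\perp B\cup D|S,\mathbf x_C\Rightarrow A\perp B|S,\mathbf x_C$; weak union: $A\perp B\cup D|S,\mathbf x_C\Rightarrow A\perp B|S\cup D,\mathbf x_C$; contraction: $A\perp B|S\cup D,\mathbf x_C$ and $A\perp D|S,\mathbf x_C\Rightarrow A\perp B\cup D|S,\mathbf x_C$; intersection: $A\perp B|S\cup D,\mathbf x_C$ and $A\perp S|B\cup D,\mathbf x_C\Rightarrow A\perp B\cup S|D,\mathbf x_C$; specialization: $A\perp B|S,\mathbf x_C$, $T\subseteq S$, $\mathbf x_T\in\mathcal R_T\Rightarrow A\perp B|S\setminus T,\mathbf x_{T\cup C}$; absorption: if for some $T\subseteq C$ one has $A\perp B|S,\mathbf x_{C\setminus T}\mathbf x_T$ for all $\mathbf x_T\in\mathcal R_T$, then $A\perp B|S\cup T,\mathbf x_{C\setminus T}$. Minimal contexts. $X_C=\mathbf x_C$ ($C$ possibly empty) is a minimal context of $\mathcal T$ if there is a statement $X_A\perp X_B|X_S,X_C=\mathbf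 x_C$ in $\mathcal J(\mathcal T)$ with $A,B\neq\emptyset$ such that for no nonempty $T\subseteq C$ is $X_A\perp X_B|X_{S\cup T},X_{C\setminus T}=\mathbf x_{C\setminus T}$ in $\mathcal J(\mathcal T)$. Let $\mathcal J(X_C=\mathbf x_C)$ be the set of CI statements $X_A\perp X_B|X_S$ with $A,B,S\subseteq[p]\setminus C$ and $X_A\perp X_B|X_S,X_C=\mathbf x_C\in\mathcal J(\mathcal T)$. The minimal context DAG $G_{X_C=\mathbf x_C}$ is the DAG on $[p]\setminus C$, with all edges $i\to j$ satisfying $i<j$, that is a minimal I-MAP of $\mathcal J(X_C=\mathbf x_C)$: all its d-separation statements lie in $\mathcal J(X_C=\mathbf x_C)$, and this fails after removing any edge. A DAG is perfect if any two parents of a common vertex are adjacent. *)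

(* Defs.v *)
From HB Require Import structures.
From mathcomp Require Import all_boot all_order all_algebra.
From mathcomp Require Import reals.
From mathcomp Require Import mpoly.

Set Implicit Arguments.
Unset Strict Implicit.
Unset Printing Implicit Defensive.

Import GRing.Theory.
Local Open Scope ring_scope.

(* The variables X_1, ..., X_p are indexed by 'I_p, so the k-th variable in
   the usual numbering is the ordinal k-1.  An outcome x_A in R_A is a partial
   assignment of values whose domain is exactly A; root is the empty one. *)
Section Outcomes.
Context {p : nat} {d : 'I_p -> nat}.

Definition outcome := {dffun forall i : 'I_p, option 'I_(d i)}.

Implicit Types (x y v w u : outcome) (A : {set 'I_p}) (k : 'I_p).

Definition dom x : {set 'I_p} := [set i | isSome (x i)].

Definition outcomes A : {set outcome} := [set x : outcome | dom x == A].

Definition restr x A : outcome :=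
  finfun (fun i => if i \in A then x i else None).

Definition combine x y : outcome :=
  finfun (fun i => if x i is Some a then Some a else y i).

Definition extend v k (a : 'I_(d k)) : outcome :=
  finfun (dfwith v (Some a : option 'I_(d k))).

Definition is_prefix x y : bool := restr y (dom x) == x.

(* initial n consists of the first n indices. *)
Definition initial (n : nat) : {set 'I_p} := [set i : 'I_p | (i < n)%N].

Definition level (n : nat) : {set outcome} := outcomes (initial n).

Definition vertex v : bool := [exists n : 'I_p.+1, v \in level n].

Definition nonleaf v : bool := [exists k : 'I_p, v \in level k].

Definition edge v w : bool :=
  [exists k : 'I_p, (v \in level k) && [exists a : 'I_(d k), w == extend v a]].

(* The edges of the path from v to its descendant u. *)
Definition path_edges v u : {set outcome * outcome} :=
  [set e | [&& edge e.1 e.2, is_prefix v e.1 & is_prefix e.2 u]].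

End Outcomes.
Arguments outcome {p} d.

(* A labeling is a total function on pairs of outcomes; only its values on
   pairs (v, w) with edge v w are ever used. *)
Section CStrees.
Context {p : nat} {d : 'I_p -> nat} {L : finType}.
Variable theta : outcome d * outcome d -> L.

Implicit Types (v w : outcome d) (St : {set outcome d}) (k : 'I_p).
Implicit Types (A B D S T : {set 'I_p}) (x c : outcome d).

Definition labels v : {set L} :=
  [set theta (v, w) | w : outcome d & edge v w].

Definition staged_tree : Prop :=
  (forall v, vertex v -> #|labels v| = #|[set w | edge v w]|) /\
  (forall v w, vertex v -> vertex w ->
     labels v = labels w \/ [disjoint labels v & labels w]).

Definition same_stage v w : bool :=
  if nonleaf v && nonleaf w then labels v == labels w else v == w.

Definition stage St : Prop :=
  exists2 v, vertex v & St = [set w | vertex w & same_stage v w].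

Definition cstree : Prop :=
  [/\ staged_tree,
      forall k (l : 'I_p) v w, v \in level k -> w \in level l -> k != l ->
        labels v <> labels w,
      forall k v w, v \in level k -> w \in level k -> same_stage v w ->
        forall a : 'I_(d k), theta (v, extend v a) = theta (w, extend w a)
    & forall k St, stage St -> St \subset level k ->
        exists2 C : {set 'I_p}, C \subset initial k &
        exists2 x, x \in outcomes C &
          St = [set combine x y | y in outcomes (initial k :\: C)]].

(* The polynomial ring has one variable for each element of L.  For v in
   level n, the set ~: dom v consists of the indices not among the first n. *)
Definition tpoly (R : realType) v : {mpoly R[#|L|]} :=
  \sum_(z in outcomes (~: dom v))
    \prod_(e in path_edges v (combine v z)) 'X_(enum_rank (theta e)).

Definition balanced (R : realType) : Prop :=
  forall k v w, v \in level k -> w \in level k -> same_stage v w ->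
  forall s r : 'I_(d k),
    tpoly R (extend v s) * tpoly R (extend w r)
    = tpoly R (extend v r) * tpoly R (extend w s).

Definition agree k St : {set 'I_p} :=
  [set i in initial k | [forall v in St, forall w in St, v i == w i]].

(* CSI A B S c is the statement X_A _||_ X_B | X_S, X_C = x_C with C = dom c
   and x_C = c.  The hypotheses on the rules make A, B, S and dom c pairwise
   disjoint in every derivable statement. *)
Inductive CSI : {set 'I_p} -> {set 'I_p} -> {set 'I_p} -> outcome d -> Prop :=
| CSI_stage k St v : stage St -> St \subset level k -> v \in St ->
    CSI [set k] (initial k :\: agree k St) set0 (restr v (agree k St))
| CSI_symmetry A B S c : CSI A B S c -> CSI B A S c
| CSI_decomposition A B D S c : [disjoint B & D] ->
    CSI A (B :|: D) S c -> CSI A B S c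
| CSI_weak_union A B D S c : [disjoint B & D] ->
    CSI A (B :|: D) S c -> CSI A B (S :|: D) c
| CSI_contraction A B D S c :
    CSI A B (S :|: D) c -> CSI A D S c -> CSI A (B :|: D) S c
| CSI_intersection A B D S c :
    CSI A B (S :|: D) c -> CSI A S (B :|: D) c -> CSI A (B :|: S) D c
| CSI_specialization A B S c T x :
    T \subset S -> x \in outcomes T ->
    CSI A B S c -> CSI A B (S :\: T) (combine x c)
| CSI_absorption A B S c T : T \subset dom c ->
    (forall x, x \in outcomes T ->
       CSI A B S (combine (restr c (dom c :\: T)) x)) ->
    CSI A B (S :|: T) (restr c (dom c :\: T)).

Definition minimal_context c : Prop :=
  exists A B S,
    [/\ A != set0, B != set0, CSI A B S c &
        forall T, T != set0 -> T \subset dom c ->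
          ~ CSI A B (S :|: T) (restr c (dom c :\: T))].

End CStrees.

(* A DAG on a subset of 'I_p is given by its set of edges (i, j), i -> j. *)
Section DAGs.
Context {p : nat}.
Implicit Types (G : {set 'I_p * 'I_p}) (A B S : {set 'I_p}).

Definition dag_on (W : {set 'I_p}) G : Prop :=
  forall i j, (i, j) \in G -> [/\ i \in W, j \in W & (i < j)%N].

Definition adjacent G : rel 'I_p := fun i j => ((i, j) \in G) || ((j, i) \in G).

(* Every vertex is a descendant of itself. *)
Definition descendant G (i j : 'I_p) : bool :=
  connect (fun a b => (a, b) \in G) i j.

Definition blocked G S (s : seq 'I_p) : Prop :=
  exists s1 s2 a m b, s = s1 ++ [:: a, m, b & s2] /\
    if ((a, m) \in G) && ((b, m) \in G)
    then forall j, descendant G m j -> j \notin S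
    else m \in S.

Definition dseparated G A B S : Prop :=
  forall a s, a \in A -> last a s \in B ->
    path (adjacent G) a s -> uniq (a :: s) -> blocked G S (a :: s).

Definition perfect G : Prop :=
  forall i j k, (i, k) \in G -> (j, k) \in G -> i != j -> adjacent G i j.

End DAGs.

Section MinimalContextDAGs.
Context {p : nat} {d : 'I_p -> nat} {L : finType}.
Variable theta : outcome d * outcome d -> L.
Implicit Types (A B S : {set 'I_p}) (c : outcome d) (G : {set 'I_p * 'I_p}).

Definition context_CI c A B S : Prop :=
  [/\ A \subset ~: dom c, B \subset ~: dom c, S \subset ~: dom c
    & CSI theta A B S c].

(* Statements with A or B empty are trivial and are not required to belong to
   the set of derivable statements. *)
Definition Imap c G : Prop :=
  forall A B S,
    A \subset ~: dom c -> B \subset ~: dom c -> S \subset ~: dom c ->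
    [disjoint A & B] -> [disjoint A & S] -> [disjoint B & S] ->
    A != set0 -> B != set0 ->
    dseparated G A B S -> context_CI c A B S.

Definition minimal_context_dag c G : Prop :=
  [/\ dag_on (~: dom c) G, Imap c G & forall e, e \in G -> ~ Imap c (G :\ e)].

End MinimalContextDAGs.

(* Main.v *)
Require Import Defs.
From mathcomp Require Import all_boot all_order all_algebra.
From mathcomp Require Import reals.
From mathcomp Require Import mpoly.

(* Both sides are equivalent to: X_1 and X_2 are not made independent by the
   level-1 stages, or no stage on level 2 is a singleton.

   Balancedness is only a condition on level 1 when all its vertices form one
   stage.  If level 2 has no singleton stage, then all its stages contain a full
   row or all contain a full column, and the required identity is trivial.  If
   {u} is a singleton stage, evaluating the labels of u at 0 and all others at 1
   kills exactly one side of the identity.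

   The only imperfect DAG on three ordered vertices is 1 -> 3 <- 2, in the empty
   context.  Underivability of CSI statements is shown by combinatorial
   invariants of the derivation rules instead of faithful distributions: the
   pair {1,2} is separated only if the level-1 stage statement separates it, and
   if {u} is a singleton stage on level 2 then X_3 is separated from X_1
   (resp. X_2) only in a context assigning to X_2 (resp. X_1) a value different
   from that of u. *)

Set Implicit Arguments.
Unset Strict Implicit.
Unset Printing Implicit Defensive.

Import GRing.Theory Num.Theory.
Local Open Scope ring_scope.

(** * Outcomes and paths *)

Section OutcomeTheory.
Context {p : nat} {d : 'I_p -> nat}.
Implicit Types (x y v w u c : outcome d) (A C T : {set 'I_p}) (i k l : 'I_p).

(** Serves both as the root of the tree and as the empty context. *)
Definition empty_outcome : outcome d := finfun (fun i => None).

Lemma outcomeP x y : (forall i, x i = y i) <-> x = y.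
Proof. by split=> [/ffunP | ->]. Qed.

Lemma empty_outcomeE i : empty_outcome i = None.
Proof. exact: ffunE. Qed.

Lemma restrE x A i : restr x A i = if i \in A then x i else None.
Proof. exact: ffunE. Qed.

Lemma combineE x y i : combine x y i = if x i is Some a then Some a else y i.
Proof. exact: ffunE. Qed.

Lemma extend_in v k (a : 'I_(d k)) : extend v a k = Some a.
Proof. by rewrite ffunE dfwith_in. Qed.

Lemma extend_out v k (a : 'I_(d k)) i : i != k -> extend v a i = v i.
Proof. by move=> ik; rewrite ffunE dfwith_out // eq_sym. Qed.

Lemma in_dom x i : (i \in dom x) = isSome (x i).
Proof. by rewrite inE. Qed.

Lemma notin_dom x i : i \notin dom x -> x i = None.
Proof. by rewrite in_dom; case: (x i). Qed.

Lemma dom0P x : dom x = set0 -> x = empty_outcome.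
Proof.
by move=> x0; apply/outcomeP => i; rewrite empty_outcomeE notin_dom ?x0 ?inE.
Qed.

Lemma dom_empty_outcome : dom empty_outcome = set0.
Proof. by apply/setP=> i; rewrite in_dom empty_outcomeE inE. Qed.

Lemma dom_restr x A : dom (restr x A) = A :&: dom x.
Proof. by apply/setP=> i; rewrite in_setI !in_dom restrE; case: (i \in A). Qed.

Lemma dom_combine x y : dom (combine x y) = dom x :|: dom y.
Proof. by apply/setP=> i; rewrite in_setU !in_dom combineE; case: (x i). Qed.

Lemma dom_extend v k (a : 'I_(d k)) : dom (extend v a) = k |: dom v.
Proof.
apply/setP=> i; rewrite in_setU1 !in_dom.
have [->|ik] := eqVneq i k; first by rewrite extend_in.
by rewrite extend_out.
Qed.

Lemma combine_emptyr x : combine x empty_outcome = x.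
Proof. by apply/outcomeP => l; rewrite combineE empty_outcomeE; case: (x l). Qed.

Lemma combine_emptyl x : combine empty_outcome x = x.
Proof. by apply/outcomeP => l; rewrite combineE empty_outcomeE. Qed.

Lemma restr_set0 x : restr x set0 = empty_outcome.
Proof. by apply: dom0P; rewrite dom_restr set0I. Qed.

Lemma outcomesE x A : (x \in outcomes A) = (dom x == A).
Proof. by rewrite inE. Qed.

(** Turns the premise of absorption at the values that [c] takes on [T] into a statement in the
    context [c] itself. *)
Lemma combine_restr c T : T \subset dom c ->
  combine (restr c (dom c :\: T)) (restr c T) = c.
Proof.
move=> Tc; apply/outcomeP => i; rewrite combineE !restrE in_setD.
case: (boolP (i \in T)) => //= iT; case: ifPn => [_|/notin_dom ->//].
by case: (c i).
Qed.

Lemma restr_outcomes c T : T \subset dom c -> restr c T \in outcomes T.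
Proof. by move=> Tc; rewrite outcomesE dom_restr; apply/eqP/setIidPl. Qed.

Lemma in_initial i n : (i \in initial n) = (i < n)%N.
Proof. by rewrite inE. Qed.

Lemma level_dom v n : v \in level n -> dom v = initial n.
Proof. by rewrite outcomesE => /eqP. Qed.

Lemma level_nonleaf v k : v \in level k -> nonleaf v.
Proof. by move=> vk; apply/existsP; exists k. Qed.

Lemma level_vertex v k : v \in level k -> vertex v.
Proof.
by move=> vk; apply/existsP; exists (widen_ord (leqnSn p) k).
Qed.

Lemma initialS k : initial k.+1 = k |: initial k :> {set 'I_p}.
Proof. by apply/setP=> i; rewrite !inE ltnS leq_eqVlt. Qed.

Lemma level_extend v k (a : 'I_(d k)) : v \in level k -> extend v a \in level k.+1.
Proof. by move=> /level_dom vk; rewrite outcomesE dom_extend vk initialS. Qed.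

(** [extend] overwrites a value that is already assigned, so it also moves sideways within a
    level. *)
Lemma level_update v k i (a : 'I_(d i)) :
  v \in level k -> (i < k)%N -> extend v a \in level k.
Proof.
move=> /level_dom vk ik; rewrite outcomesE dom_extend vk.
by apply/eqP/setUidPr; rewrite sub1set in_initial.
Qed.

Lemma level_restr v k l :
  v \in level k -> (l <= k)%N -> restr v (initial l) \in level l.
Proof.
move=> /level_dom vk lk; rewrite outcomesE dom_restr vk; apply/eqP/setIidPl.
by apply/subsetP=> i; rewrite !in_initial => /leq_trans->.
Qed.

Lemma level_edge v k (a : 'I_(d k)) : v \in level k -> edge v (extend v a).
Proof. by move=> vk; apply/existsP; exists k; rewrite vk; apply/existsP; exists a. Qed.

Lemma prefixP v w : reflect (forall i, i \in dom v -> w i = v i) (is_prefix v w).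
Proof.
apply: (iffP eqP) => [e i iv|e]; first by rewrite -e restrE iv.
apply/outcomeP => i; rewrite restrE; case: ifPn => [/e //|/notin_dom ->//].
Qed.

Lemma prefix_dom v w : is_prefix v w -> dom v \subset dom w.
Proof.
by move=> /prefixP vw; apply/subsetP=> i iv; rewrite in_dom vw // -in_dom.
Qed.

Lemma path_edges_self v : path_edges v v = set0.
Proof.
apply/setP=> -[u w]; rewrite !inE /=; apply/negP=> /and3P [].
move=> /existsP [k /andP [uk /existsP [a /eqP ->]]] /prefix_dom vu /prefix_dom.
rewrite dom_extend => uv; have := subsetP (subset_trans uv vu) k.
by rewrite setU11 (level_dom uk) in_initial ltnn => /(_ isT).
Qed.

Lemma path_edges_extend v k (a : 'I_(d k)) :
  v \in level k -> path_edges v (extend v a) = [set (v, extend v a)].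
Proof.
move=> vk; apply/setP=> -[u w]; rewrite !inE /=; apply/and3P/eqP; last first.
  case=> -> ->; split; first exact: level_edge.
    by apply/prefixP.
  by apply/prefixP.
case=> /existsP [l /andP [ul /existsP [b /eqP ->]]] vu wv.
have dv := level_dom vk; have du := level_dom ul.
(* The prefix relations squeeze the level [l] of the edge: the first gives [k <= l], the second
   [l <= k]. *)
have lk : l = k.
  have [kl|lk|/val_inj//] := ltngtP l k.
    have /subsetP/(_ l) := prefix_dom vu.
    by rewrite dv du !in_initial ltnn kl => /(_ isT).
  have := subsetP (prefix_dom wv) l; rewrite !dom_extend setU11 dv !inE.
  by rewrite ltnNge (ltnW lk) orbF => /(_ isT)/eqP.
subst l.
have uv : u = v.
  apply/outcomeP => i; have [iv|iv] := boolP (i \in dom v).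
    by move/prefixP: vu => ->.
  by rewrite !notin_dom // du -dv.
rewrite uv in wv *; congr (_, _); congr extend.
have := prefixP _ _ wv k; rewrite dom_extend setU11 !extend_in => /(_ isT).
by case.
Qed.

End OutcomeTheory.
Arguments empty_outcome {p d}.

(** * Stages of a CStree *)

(** Stated for optional values because outcomes store them; it supplies vertices that differ from a
    given one in a chosen coordinate. *)
Lemma exists_other_value n (o : option 'I_n) :
  (2 <= n)%N -> exists b : 'I_n, Some b != o.
Proof.
case: n o => [|[|n]] // o _; have [e|ne] := eqVneq (Some ord0) o; last by exists ord0.
by exists ord_max; rewrite -e.
Qed.

Section CStreeTheory.
Context {p : nat} {d : 'I_p -> nat} {L : finType}.
Variable theta : outcome d * outcome d -> L.
Hypothesis theta_cstree : cstree theta.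
Hypothesis d_ge2 : forall i, (2 <= d i)%N.
Implicit Types (x v w u c : outcome d) (A B C D S T St : {set 'I_p}) (i j k l : 'I_p).

Lemma same_stageE v w k : v \in level k -> w \in level k ->
  same_stage theta v w = (labels theta v == labels theta w).
Proof. by move=> vk wk; rewrite /same_stage !(@level_nonleaf _ _ _ k). Qed.

Lemma same_stage_trans k v w u : v \in level k -> w \in level k -> u \in level k ->
  same_stage theta v w -> same_stage theta v u = same_stage theta w u.
Proof.
move=> vk wk uk; rewrite (same_stageE vk wk) (same_stageE vk uk).
by rewrite (same_stageE wk uk) => /eqP->.
Qed.

(** Condition (1) rules out equal label sets on different levels, and a leaf shares its stage with
    no other vertex. *)
Lemma same_stage_level v w k :
  v \in level k -> vertex w -> same_stage theta v w -> w \in level k.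
Proof.
move=> vk wV; rewrite /same_stage (level_nonleaf vk) /=.
case: ifP => [/existsP [l wl]|_ /eqP <- //].
move=> /eqP e; have [<- //|kl] := eqVneq l k.
by case: theta_cstree => _ /(_ k l v w vk wl); rewrite eq_sym => /(_ kl).
Qed.

Lemma stage_classE (St : {set outcome d}) k u :
  stage theta St -> St \subset level k -> u \in St ->
  St = [set w in level k | same_stage theta u w].
Proof.
case=> v vV defSt /subsetP sub uSt; have uk := sub _ uSt.
have vk : v \in level k by apply: sub; rewrite defSt inE vV /same_stage !eqxx if_same.
have vu : same_stage theta v u by move: uSt; rewrite defSt inE => /andP [].
apply/setP=> w; rewrite [RHS]inE; apply/idP/andP => [wSt|[wk uw]].
  have wk := sub _ wSt; split=> //; move: wSt; rewrite defSt inE => /andP [_].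
  by rewrite -(same_stage_trans vk uk wk vu).
rewrite defSt inE (level_vertex wk).
by rewrite (same_stage_trans vk uk wk vu).
Qed.

Lemma stage_of v k : v \in level k ->
  stage theta [set w in level k | same_stage theta v w].
Proof.
move=> vk; exists v; first exact: level_vertex vk.
apply/setP=> w; rewrite [RHS]inE [LHS]inE; apply/andP/andP => -[].
  by move=> /level_vertex.
by move=> wV vw; split=> //; apply: same_stage_level vw.
Qed.

(** Condition (3) seen from a member [v] of the stage: only the index set [C] of the context is
    recorded, since the values on it are those of [v]. *)
Definition stage_fixes v k C : Prop := C \subset initial k /\
  forall w, w \in level k -> same_stage theta v w = [forall i in C, w i == v i].

Lemma stage_context v k : v \in level k -> exists C, stage_fixes v k C.
Proof.
move=> vk; case: theta_cstree => _ _ _ /(_ k _ (stage_of vk)) [].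
  by apply/subsetP=> w; rewrite [_ \in _]inE => /andP [].
move=> C Ck [x + defSt]; rewrite outcomesE => /eqP domx; exists C; split=> // w wk.
(* As [v] lies in its own stage, the fixed part [x] of that stage is the restriction of [v] to
   [C]. *)
have vx i : i \in C -> v i = x i.
  have : v \in [set w in level k | same_stage theta v w].
    by rewrite [_ \in _]inE vk /same_stage !eqxx if_same.
  rewrite defSt => /imsetP [y _ ->] iC; rewrite combineE.
  by case E: (x i) => //; move: iC; rewrite -domx in_dom E.
move/setP/(_ w): defSt; rewrite [_ \in [set _ in _ | _]]inE wk /= => ->.
apply/imsetP/forall_inP => [[y _ ->] i iC|wv].
  rewrite vx // combineE.
  by case E: (x i) => //; move: iC; rewrite -domx in_dom E.
exists (restr w (initial k :\: C)).
  by rewrite outcomesE dom_restr (level_dom wk); apply/eqP/setIidPl; apply: subsetDl.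
apply/outcomeP => i; rewrite combineE restrE in_setD -domx in_dom.
case E: (x i) => [a|] /=; last first.
  by case: ifPn => // ik; rewrite notin_dom // (level_dom wk).
have iC : i \in C by rewrite -domx in_dom E.
by rewrite (eqP (wv i iC)) vx.
Qed.

Lemma stage_update v k C i (b : 'I_(d i)) : v \in level k -> stage_fixes v k C ->
  (i < k)%N -> i \notin C -> same_stage theta v (extend v b).
Proof.
move=> vk [Ck vC] ik iC; rewrite vC ?level_update //; apply/forall_inP => j jC.
by rewrite extend_out //; apply: contraNneq iC => <-.
Qed.

(** Outside [C] a coordinate can be changed to a second value without leaving the stage, so the
    members do not agree there. *)
Lemma stage_fixes_agree v k C : v \in level k -> stage_fixes v k C ->
  agree k [set w in level k | same_stage theta v w] = C.
Proof.
move=> vk vCk; have [Ck vC] := vCk.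
have inSt w : w \in level k -> same_stage theta v w ->
    w \in [set w in level k | same_stage theta v w].
  by move=> wk vw; rewrite [_ \in _]inE wk.
apply/setP=> i; rewrite [LHS]inE in_initial; apply/andP/idP.
  case=> ik /forall_inP eqi; apply/negPn/negP => iC.
  have [b /eqP] := exists_other_value (v i) (d_ge2 i); apply.
  rewrite -(extend_in v b).
  have /eqi/forall_inP eqb :=
    inSt _ (level_update b vk ik) (stage_update b vk vCk ik iC).
  by apply/eqP/eqb; apply: inSt => //; rewrite /same_stage !eqxx if_same.
move=> iC; split; first by rewrite -in_initial (subsetP Ck).
apply/forall_inP => w; rewrite [_ \in _]inE => /andP [wk].
rewrite vC // => /forall_inP/(_ i iC)/eqP ->.
apply/forall_inP => u; rewrite [_ \in _]inE => /andP [uk].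
by rewrite vC // => /forall_inP/(_ i iC)/eqP ->.
Qed.

Lemma CSI_stage_fixes v k C : v \in level k -> stage_fixes v k C ->
  CSI theta [set k] (initial k :\: C) set0 (restr v C).
Proof.
move=> vk vC; rewrite -(stage_fixes_agree vk vC).
apply: CSI_stage; first exact: stage_of.
  by apply/subsetP=> w; rewrite [_ \in _]inE => /andP [].
by rewrite [_ \in _]inE vk /same_stage !eqxx if_same.
Qed.

(** Pairwise disjointness of the four sets is phrased as a count at each index, so that most rules
    reduce to a finite check on membership bits. *)
Lemma CSI_disjoint A B S c : CSI theta A B S c ->
  forall i, ((i \in A) + (i \in B) + (i \in S) + (i \in dom c) <= 1)%N.
Proof.
elim=> {A B S c}.
- move=> k St v _ _ _ i; have ai : i \in agree k St -> (i < k)%N.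
    by rewrite [_ \in _]inE in_initial => /andP [].
  rewrite dom_restr in_setI in_setD in_initial in_set0 in_set1.
  move: ai; have [->|_] := eqVneq i k.
    by rewrite ltnn; case: (k \in agree _ _) => [/(_ isT)|].
  by move=> _; case: (i \in agree _ _); case: (_ < _)%N; case: (i \in dom v).
- by move=> A B S c _ IH i; rewrite [(_ + (i \in A))%N]addnC.
- move=> A B D S c _ _ IH i; move: (IH i); rewrite in_setU.
  by do !case: (i \in _).
- move=> A B D S c /pred0P BD _ IH i; move: (IH i) (BD i); rewrite /= !in_setU.
  by do !case: (i \in _).
- move=> A B D S c _ IH1 _ IH2 i; move: (IH1 i) (IH2 i); rewrite /= !in_setU.
  by do !case: (i \in _).
- move=> A B D S c _ IH1 _ IH2 i; move: (IH1 i) (IH2 i); rewrite /= !in_setU.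
  by do !case: (i \in _).
- move=> A B S c T x /subsetP TS; rewrite outcomesE => /eqP xT _ IH i.
  move: (IH i) (TS i); rewrite dom_combine xT in_setU in_setD.
  by do !case: (i \in _) => //; move=> _ /(_ isT).
- move=> A B S c T Tc _ IH i; have := IH _ (restr_outcomes Tc) i.
  rewrite combine_restr // dom_restr in_setU in_setI in_setD.
  move: (subsetP Tc i).
  by do !case: (i \in _) => //; move=> /(_ isT).
Qed.

(** Symmetric in [A] and [B] as well as in [i] and [j], so the symmetry rule preserves every
    invariant phrased with it. *)
Definition separates i j A B := (i \in A) && (j \in B) || (j \in A) && (i \in B).

Lemma separatesC i j A B : separates i j A B = separates i j B A.
Proof. by rewrite /separates orbC andbC [X in _ || X]andbC. Qed.

Lemma separatesU i j A B D :
  separates i j A (B :|: D) = separates i j A B || separates i j A D.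
Proof. by rewrite /separates !in_setU; do !case: (_ \in _). Qed.

End CStreeTheory.

(** * Three variables *)

Lemma in_initial_max n (k : 'I_n.+1) : ord_max \notin (initial k : {set 'I_n.+1}).
Proof. by rewrite in_initial -leqNgt -ltnS. Qed.

(** Lets [i] and [j] stand for the first two variables in either order, so that symmetric arguments
    are made only once. *)
Lemma ord3_cases (i j l : 'I_3) : i != j -> i != ord_max -> j != ord_max ->
  [|| l == i, l == j | l == ord_max].
Proof.
rewrite -!(inj_eq val_inj) /=.
by case: i j l => [[|[|[|i]]] ?] [[|[|[|j]]] ?] [[|[|[|l]]] ?].
Qed.

Lemma ord3_lt_max (i : 'I_3) : i != ord_max -> (i < (ord_max : 'I_3))%N.
Proof. by case: i => [[|[|[]]]]. Qed.

(** A path consisting of one edge has no inner vertex at which it could be blocked. *)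
Lemma dseparated_nonadjacent p (G : {set 'I_p * 'I_p}) (A B S : {set 'I_p}) a b :
  dseparated G A B S -> a \in A -> b \in B -> a != b -> ~~ adjacent G a b.
Proof.
move=> sep aA bB ab; apply/negP => adj.
have [] := sep a [:: b] aA bB; rewrite /= ?adj ?inE ?ab //.
by move=> [|? [|? [|? ?]]] [s2 [? [? [? []]]]].
Qed.

Section ThreeVariables.
Context {d : 'I_3 -> nat} {L : finType}.
Variable theta : outcome d * outcome d -> L.
Hypothesis theta_cstree : cstree theta.
Hypothesis d_ge2 : forall i, (2 <= d i)%N.
Implicit Types (x v w u c : outcome d) (A B C D S T : {set 'I_3}) (i j k l : 'I_3).

Local Notation X1 := (ord0 : 'I_3).
Local Notation X2 := (Ordinal (isT : 1 < 3)%N).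
Local Notation X3 := (ord_max : 'I_3).

(** * Invariants of the derivation rules *)

Lemma outcomes_neq0 T : exists x : outcome d, x \in outcomes T.
Proof.
pose x : outcome d :=
  finfun (fun i => if i \in T then Some (Ordinal (ltnW (d_ge2 i))) else None).
exists x; rewrite outcomesE; apply/eqP/setP => i.
by rewrite in_dom ffunE; case: (i \in T).
Qed.

(** Induction on the derivation: a conclusion separating 1 and 2 always has a premise that does, and
    a stage statement doing so comes from a level-1 stage not fixing X_1. *)
Lemma CSI_separates12 A B S c : CSI theta A B S c -> separates X1 X2 A B ->
  exists v w, [/\ v \in level X2, w \in level X2, same_stage theta v w & v != w].
Proof.
elim=> {A B S c}.
- move=> k St v stSt Stk vSt; rewrite /separates !in_set1 !in_setD !in_initial.
  (* Only [k = X2] survives: no variable precedes [X1], and the stage statements of [X3] have [X3]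
     alone on one side. *)
  case: k Stk => [[|[|[]]]] //= k3 Stk; rewrite ?andbF //= !andbT => /negP a1.
  have ek : Ordinal k3 = X2 by apply: val_inj.
  rewrite ek in Stk a1 *.
  have [w wSt vw] : exists2 w, w \in St & v X1 != w X1.
    apply/exists_inP; apply: contraT; rewrite negb_exists_in => /forall_inP eqv.
    case: a1; rewrite [_ \in _]inE in_initial /=.
    apply/forall_inP=> w wSt; apply/forall_inP=> u uSt.
    by rewrite -(eqP (negPn (eqv w wSt))) (eqP (negPn (eqv u uSt))).
  have vk := subsetP Stk _ vSt; have wk := subsetP Stk _ wSt.
  exists v, w; split=> //; last by apply: contraNneq vw => ->.
  by move: wSt; rewrite (stage_classE (k := X2) stSt Stk vSt) [_ \in _]inE => /andP [].
- by move=> A B S c _ IH; rewrite separatesC.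
- by move=> A B D S c _ _; rewrite separatesU => IH AB; apply: IH; rewrite AB.
- by move=> A B D S c _ _; rewrite separatesU => IH AB; apply: IH; rewrite AB.
- by move=> A B D S c _ IH1 _ IH2; rewrite separatesU => /orP [/IH1|/IH2].
- by move=> A B D S c _ IH1 _ IH2; rewrite separatesU => /orP [/IH1|/IH2].
- by [].
(* Absorption has a premise to appeal to because [T] has at least one outcome. *)
- by move=> A B S c T _ _ IH; have [x /IH] := outcomes_neq0 T.
Qed.

Definition singleton_stage v :=
  forall w, w \in level X3 -> same_stage theta v w -> w = v.

(** A stage statement separating [i] from [X3] leaves [i] free. If its context did not give [j] a
    value other than that of [v], then [v] would lie in this stage, which has several members. *)
Lemma CSI_singleton_stage v A B S c :
  v \in level X3 -> singleton_stage v -> CSI theta A B S c ->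
  forall i j, i != j -> i != X3 -> j != X3 ->
  separates i X3 A B -> c j != None /\ c j != v j.
Proof.
move=> vl vsing; elim=> {A B S c}.
- move=> k St u stSt Stk uSt i j ij i3 j3.
  rewrite /separates !in_set1 !in_setD (negPf (in_initial_max k)) andbF andbF /=.
  case/andP=> /eqP ek /andP [ia _]; rewrite -{k}ek in Stk ia *.
  have ul := subsetP Stk _ uSt; have [C uC] := stage_context theta_cstree ul.
  have [Cl inC] := uC.
  have defSt := stage_classE (k := X3) stSt Stk uSt.
  have aC : agree X3 St = C by rewrite defSt (stage_fixes_agree _ _ uC).
  rewrite aC in ia *; apply/andP; rewrite -negb_or; apply/negP => cj.
  (* The context can only involve [j], and there it agrees with [v] by assumption. *)
  have uv : same_stage theta u v.
    rewrite inC //; apply/forall_inP => l lC.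
    case/or3P: (ord3_cases l ij i3 j3) => /eqP el; rewrite el in lC *.
    + by rewrite lC in ia.
    + move: cj; rewrite restrE lC -[u j == None]negbK; have := in_dom u j.
      rewrite (level_dom ul) in_initial ord3_lt_max //.
      by case: (u j) => //= b _; rewrite eq_sym.
    + by have := subsetP Cl _ lC; rewrite (negPf (in_initial_max _)).
  have euv : u = v.
    apply: vsing => //; move: uv.
    by rewrite (same_stageE _ ul vl) (same_stageE _ vl ul) eq_sym.
  (* Changing the free coordinate [i] yields a second member of the singleton stage. *)
  rewrite euv in uC; have [b /eqP] := exists_other_value (v i) (d_ge2 i); apply.
  have e : extend v b = v.
    apply: vsing; [apply: level_update|apply: (stage_update _ _ uC)] => //;
    exact: ord3_lt_max.
  by rewrite -[in RHS]e extend_in.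
- move=> A B S c _ IH i j ij i3 j3; rewrite separatesC.
  exact: IH.
- move=> A B D S c _ _ IH i j ij i3 j3 AB; apply: (IH i j) => //.
  by rewrite separatesU AB.
- move=> A B D S c _ _ IH i j ij i3 j3 AB; apply: (IH i j) => //.
  by rewrite separatesU AB.
- move=> A B D S c _ IH1 _ IH2 i j ij i3 j3; rewrite separatesU.
  by case/orP; [apply: IH1|apply: IH2].
- move=> A B D S c _ IH1 _ IH2 i j ij i3 j3; rewrite separatesU.
  by case/orP; [apply: IH1|apply: IH2].
- move=> A B S c T x TS; rewrite outcomesE => /eqP xT csi IH i j ij i3 j3 AB.
  have [cj0 cjv] := IH i j ij i3 j3 AB.
  (* By disjointness the newly specialized indices avoid [j], which already lies in the context, so
     its value persists. *)
  rewrite combineE notin_dom // xT; apply: contra cj0 => jT.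
  move: (CSI_disjoint csi j); rewrite (subsetP TS) // in_dom.
  by case: (c j) => //= ?; rewrite !addn1.
- move=> A B S c T Tc _ IH i j ij i3 j3 AB.
  (* Among the absorbed contexts one gives [j] the excluded value [v j]. *)
  have jT : j \notin T.
    apply/negP => jT; have [x xT] := outcomes_neq0 T.
    have vj : isSome (v j) by rewrite -in_dom (level_dom vl) in_initial ord3_lt_max.
    case E: (v j) vj => [b|] // _.
    have xbT : extend x b \in outcomes T.
      rewrite outcomesE dom_extend; rewrite outcomesE in xT; rewrite (eqP xT).
      by apply/eqP/setUidPr; rewrite sub1set.
    have [_] := IH _ xbT i j ij i3 j3 AB.
    by rewrite combineE restrE in_setD jT /= extend_in E eqxx.
  have := IH _ (restr_outcomes Tc) i j ij i3 j3 AB; rewrite combine_restr //.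
  move=> [cj cjv]; rewrite restrE in_setD jT /=.
  by rewrite in_dom; case: (c j) cj cjv.
Qed.

(** * Stages on levels 1 and 2 *)

Lemma initial_X2 : initial X2 = [set X1].
Proof. by apply/setP => -[[|[|[|l]]] ?]; rewrite !inE. Qed.

Lemma initial_X3 i j : i != j -> i != X3 -> j != X3 -> initial X3 = [set i; j].
Proof.
move=> ij i3 j3; apply/setP=> l; rewrite in_set2; have [->|l3] := eqVneq l X3.
  by rewrite (negPf (in_initial_max _)) !(eq_sym X3) (negPf i3) (negPf j3).
rewrite in_initial ord3_lt_max //; have := ord3_cases l ij i3 j3.
by rewrite (negPf l3) orbF => ->.
Qed.

(** A context on level 1 is empty or consists of X_1, and fixing X_1 leaves a single vertex. *)
Lemma stage_fixes_X2 v w C :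
  v \in level X2 -> w \in level X2 -> stage_fixes theta v X2 C ->
  same_stage theta v w -> v != w -> C = set0.
Proof.
move=> vl wl [Cl vC]; rewrite vC // => /forall_inP wv; apply: contraNeq => C0.
have {}C0 : C = [set X1].
  by move: Cl; rewrite initial_X2 subset1 (negPf C0) orbF => /eqP.
apply/eqP/outcomeP => l; have [->|l1] := eqVneq l X1.
  by rewrite (eqP (wv X1 _)) // C0 set11.
by rewrite !notin_dom ?(level_dom wl) ?(level_dom vl) ?initial_X2 ?in_set1.
Qed.

Lemma CSI_independent12 v w : v \in level X2 -> w \in level X2 ->
  same_stage theta v w -> v != w -> CSI theta [set X2] [set X1] set0 empty_outcome.
Proof.
move=> vl wl vw ne; have [C vC] := stage_context theta_cstree vl.
have C0 := stage_fixes_X2 vl wl vC vw ne; rewrite C0 in vC.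
have := CSI_stage_fixes theta_cstree d_ge2 vl vC; rewrite initial_X2 setD0.
by rewrite [restr _ _]dom0P // dom_restr set0I.
Qed.

Lemma same_stage_X2 v w : v \in level X2 -> w \in level X2 ->
  same_stage theta v w -> v != w -> forall u, u \in level X2 -> same_stage theta v u.
Proof.
move=> vl wl vw ne u ul; have [C vC] := stage_context theta_cstree vl.
have C0 := stage_fixes_X2 vl wl vC vw ne; rewrite C0 in vC.
by rewrite vC.2 //; apply/forall_inP => l; rewrite in_set0.
Qed.

(** With level 2 viewed as a grid with coordinates X_1 and X_2, the stage contains the line through
    [v] in direction [j]. *)
Definition stage_free j v := [forall b : 'I_(d j), same_stage theta v (extend v b)].

Lemma stage_freeE v C j : v \in level X3 -> stage_fixes theta v X3 C -> j != X3 ->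
  stage_free j v = (j \notin C).
Proof.
move=> vl vC j3; apply/forallP/idP => [fr|jC b]; last first.
  by apply: (stage_update _ vl vC) => //; apply: ord3_lt_max.
apply/negP => jC; have [b bv] := exists_other_value (v j) (d_ge2 j).
have := fr b; rewrite vC.2 ?level_update ?ord3_lt_max // => /forall_inP/(_ j jC).
by rewrite extend_in; apply/negP.
Qed.

Lemma level_X3_eq i j v w : i != j -> i != X3 -> j != X3 ->
  v \in level X3 -> w \in level X3 -> v i = w i -> v j = w j -> v = w.
Proof.
move=> ij i3 j3 vl wl ei ej; apply/outcomeP => l.
case/or3P: (ord3_cases l ij i3 j3) => /eqP-> //.
by rewrite !notin_dom // ?(level_dom vl) ?(level_dom wl) in_initial_max.
Qed.

(** Without singletons every stage on level 2 contains a line of the grid. Two stages containing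
    lines of different directions meet where the lines cross, hence coincide and are free in both
    directions. *)
Lemma all_stage_free :
  (forall v, v \in level X3 -> ~ singleton_stage v) ->
  (forall v, v \in level X3 -> stage_free X2 v) \/
  (forall v, v \in level X3 -> stage_free X1 v).
Proof.
move=> nosing.
have onefree i j v : i != j -> i != X3 -> j != X3 -> v \in level X3 ->
    ~~ stage_free j v -> stage_free i v.
  move=> ij i3 j3 vl; have [C vC] := stage_context theta_cstree vl.
  rewrite !(stage_freeE vl vC) // negbK => jC.
  apply/negP => iC; apply: (nosing v vl) => w wl.
  rewrite vC.2 // => /forall_inP wv.
  by apply: (level_X3_eq ij) => //; apply/eqP; apply: wv.
case: (boolP [forall v in level X3, stage_free X2 v]) => [/forall_inP|]; first by left.
rewrite negb_forall_in => /exists_inP [v vl v2]; right=> w wl; apply: contraT => w1.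
have w2 : stage_free X2 w by apply: onefree w1.
have v1 : stage_free X1 v by apply: onefree v2.
have [C vC] := stage_context theta_cstree vl.
have [D wD] := stage_context theta_cstree wl.
rewrite !(stage_freeE vl vC) ?negbK // in v1 v2.
rewrite !(stage_freeE wl wD) ?negbK // in w1 w2.
have : isSome (w X1) by rewrite -in_dom (level_dom wl) in_initial.
case E: (w X1) => [a|] // _.
(* [extend v a] is the crossing of the line through [v] in direction [X1] with the line through [w]
   in direction [X2]. *)
have ul : extend v a \in level X3 by apply: level_update.
have vu : same_stage theta v (extend v a) by apply: (stage_update _ vl vC).
have wu : same_stage theta w (extend v a).
  rewrite wD.2 //; apply/forall_inP => l lD.
  case/or3P: (@ord3_cases X1 X2 l isT isT isT) => /eqP el; rewrite el in lD *.
  - by rewrite extend_in E.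
  - by rewrite lD in w2.
  - by have := subsetP wD.1 _ lD; rewrite (negPf (in_initial_max _)).
(* The common stage contains the [X2]-line through [w], although the stage of [v] fixes [X2]. *)
have [b bv] := exists_other_value (v X2) (d_ge2 X2).
have bl : extend w b \in level X3 by apply: level_update.
have : same_stage theta v (extend w b).
  rewrite (same_stage_trans vl ul bl) // -(same_stage_trans wl ul bl) //.
  exact: (stage_update _ wl wD).
by rewrite vC.2 // => /forall_inP/(_ _ v2); rewrite extend_in (negPf bv).
Qed.

(** * Derivable statements and an isolated vertex *)

Lemma CSI_stage_free i j : i != j -> i != X3 -> j != X3 ->
  (forall v, v \in level X3 -> stage_free j v) ->
  CSI theta [set X3] [set j] [set i] empty_outcome.
Proof.
move=> ij i3 j3 fr.
(* The statement is derived in each context X_i = x_i first; absorption then merges these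
   contexts. *)
have ctx x : x \in outcomes [set i] -> CSI theta [set X3] [set j] set0 x.
  rewrite outcomesE => /eqP xi; pose b : 'I_(d j) := Ordinal (ltnW (d_ge2 j)).
  have vl : extend x b \in level X3.
    by rewrite outcomesE dom_extend xi (initial_X3 ij) // setUC.
  have [C vC] := stage_context theta_cstree vl.
  have := fr _ vl; rewrite (stage_freeE vl vC) // => jC.
  have := CSI_stage_fixes theta_cstree d_ge2 vl vC.
  have Ci : C \subset [set i].
    apply/subsetP=> l lC; have := subsetP vC.1 _ lC.
    rewrite (initial_X3 ij) // in_set2 in_set1.
    by case/orP => // /eqP el; rewrite el (negPf jC) in lC.
  rewrite (initial_X3 ij) //; move: Ci; rewrite subset1 => /orP [] /eqP->.
    have -> : [set i; j] :\: [set i] = [set j].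
      apply/setP=> l; rewrite in_setD in_set2 !in_set1; have [->|//] := eqVneq l i.
      by rewrite (negPf ij).
    congr (CSI _ _ _ _ _); rewrite -xi; apply/outcomeP => l; rewrite restrE.
    case: ifPn => [lx|/notin_dom->//]; rewrite extend_out //.
    by apply: contraTneq lx => ->; rewrite xi in_set1 eq_sym.
  (* The stage has empty context: weak union moves [i] into the conditioning set, and specialization
     fixes it to [x]. *)
  rewrite setD0 restr_set0 setUC => /CSI_weak_union.
  rewrite disjoints1 in_set1 eq_sym ij => /(_ isT)/CSI_specialization -/(_ [set i] x).
  rewrite set0U setDv combine_emptyr; apply=> //.
  by rewrite outcomesE xi.
have [c ci] := outcomes_neq0 [set i]; have domc := ci; rewrite outcomesE in domc.
(* Only the domain of [c] matters here, since all of it is absorbed. *)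
have := @CSI_absorption _ _ _ theta [set X3] [set j] set0 c [set i].
rewrite (eqP domc) setDv restr_set0 set0U; apply=> // x xi.
by rewrite combine_emptyl; apply: ctx.
Qed.

Lemma CSI_isolated i j : i != j -> i != X3 -> j != X3 ->
  (forall v, v \in level X3 -> stage_free j v) ->
  CSI theta [set j] [set i] set0 empty_outcome ->
  CSI theta [set j] [set i; X3] set0 empty_outcome.
Proof.
move=> ij i3 j3 fr ji; rewrite setUC; apply: CSI_contraction ji.
by rewrite set0U; apply: CSI_symmetry; apply: CSI_stage_free.
Qed.

(** As [i] and [X3] are adjacent, a d-separation between nonempty sets has [{j}] as one side, and it
    follows from the given statement by decomposition and weak union. *)
Lemma Imap_isolated i j : i != j -> i != X3 -> j != X3 ->
  CSI theta [set j] [set i; X3] set0 empty_outcome ->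
  Imap theta empty_outcome [set (i, X3)].
Proof.
move=> ij i3 j3 csi.
have memj A B S :
    [disjoint A & B] -> [disjoint A & S] -> [disjoint B & S] -> B != set0 ->
    j \in A -> (i \in A -> X3 \in B -> False) -> (X3 \in A -> i \in B -> False) ->
    CSI theta A B S empty_outcome.
  move=> AB AS BS B0 jA no1 no2.
  have jB : j \notin B by rewrite (disjointFr AB).
  have jS : j \notin S by rewrite (disjointFr AS).
  have -> : A = [set j].
    apply/setP=> l; rewrite in_set1; have [->//|lj] := eqVneq l j; apply/negP => lA.
    have [b bB] := set0Pn _ B0.
    have bl : b != l by apply: contraTneq bB => ->; rewrite (disjointFr AB).
    have bj : b != j by apply: contraNneq jB => <-.
    case/or3P: (ord3_cases l ij i3 j3) => /eqP el; rewrite el ?eqxx // in lj lA bl.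
      case/or3P: (ord3_cases b ij i3 j3) => /eqP eb; rewrite eb ?eqxx // in bj bl bB.
      exact: no1.
    case/or3P: (ord3_cases b ij i3 j3) => /eqP eb; rewrite eb ?eqxx // in bj bl bB.
    exact: no2.
  rewrite -[S]set0U; apply: CSI_weak_union => //.
  (* [D] is what decomposition has to discard. *)
  pose D := [set i; X3] :\: (B :|: S).
  apply: (@CSI_decomposition _ _ _ _ _ _ D).
    rewrite -setI_eq0; apply/eqP/setP=> l; rewrite /D !inE.
    by case: (l \in B); case: (l \in S).
  suff -> : B :|: S :|: D = [set i; X3] by [].
  apply/setP=> l; rewrite in_setU in_setD in_set2.
  have [lBS|//] := boolP (l \in B :|: S); rewrite /=; apply/esym.
  case/or3P: (ord3_cases l ij i3 j3) => /eqP el; rewrite el ?eqxx ?orbT // in lBS *.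
  by move: lBS; rewrite in_setU (negPf jB) (negPf jS).
move=> A B S _ _ _ AB AS BS A0 B0 sep.
have adj : adjacent [set (i, X3)] i X3 by rewrite /adjacent set11.
have adj' : adjacent [set (i, X3)] X3 i by rewrite /adjacent set11 orbT.
have no1 : i \in A -> X3 \in B -> False.
  by move=> iA B3; have := dseparated_nonadjacent sep iA B3 i3; rewrite adj.
have no2 : X3 \in A -> i \in B -> False.
  move=> A3 iB; have := dseparated_nonadjacent sep A3 iB.
  by rewrite adj' eq_sym => /(_ i3).
split; rewrite ?dom_empty_outcome ?setC0 ?subsetT //.
have [jA|jA] := boolP (j \in A); first exact: memj.
have [jB|jB] := boolP (j \in B).
  apply: CSI_symmetry; apply: memj => //; first by rewrite disjoint_sym.
    by move=> iB A3; apply: no2.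
  by move=> B3 iA; apply: no1.
have [a aA] := set0Pn _ A0; have [b bB] := set0Pn _ B0.
have ab : a != b by apply: contraTneq bB => <-; rewrite (disjointFr AB).
case/or3P: (ord3_cases a ij i3 j3) => /eqP ea; rewrite ea ?(negPf jA) // in aA ab;
case/or3P: (ord3_cases b ij i3 j3) => /eqP eb; rewrite eb ?eqxx ?(negPf jB) // in bB ab.
  by case: (no1 aA bB).
by case: (no2 aA bB).
Qed.

(** * The collider 1 -> 3 <- 2 *)

Definition collider : {set 'I_3 * 'I_3} := [set (X1, X3); (X2, X3)].

Lemma collider_remove i j : i != j -> i != X3 -> j != X3 ->
  collider :\ (i, X3) = [set (j, X3)].
Proof.
case/or3P: (@ord3_cases X1 X2 i isT isT isT) => /eqP->;
case/or3P: (@ord3_cases X1 X2 j isT isT isT) => /eqP-> // _ _ _;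
apply/setP=> -[a b]; rewrite !inE !xpair_eqE.
  by have [->|] := eqVneq a X1; case: (b == X3).
by have [->|] := eqVneq a X2; case: (b == X3); rewrite /= ?orbF.
Qed.

Lemma collider_edge i : i != X3 -> (i, X3) \in collider.
Proof.
move=> i3; case/or3P: (@ord3_cases X1 X2 i isT isT isT) => /eqP ei; rewrite ei // in i3 *;
by rewrite !in_set2 !xpair_eqE.
Qed.

(** Edges increase, so the only vertex with two parents can be [X3], with parents [X1] and [X2]. *)
Lemma dag_on_perfect (W : {set 'I_3}) G : dag_on W G ->
  ((X1, X3) \in G -> (X2, X3) \in G -> (X1, X2) \in G) -> perfect G.
Proof.
move=> dag coll i j k ik jk ij; rewrite /adjacent.
have [_ _ lik] := dag _ _ ik; have [_ _ ljk] := dag _ _ jk.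
have e1 (l : 'I_3) : l = 0%N :> nat -> l = X1 by move=> ?; apply: val_inj.
have e2 (l : 'I_3) : l = 1%N :> nat -> l = X2 by move=> ?; apply: val_inj.
have e3 (l : 'I_3) : l = 2%N :> nat -> l = X3 by move=> ?; apply: val_inj.
case: i j k => [[|[|[|i]]] hi] [[|[|[|j]]] hj] [[|[|[|k]]] hk] // in ij lik ljk ik jk *.
  rewrite (e1 (Ordinal hi)) // (e3 (Ordinal hk)) // in ik *.
  by rewrite (e2 (Ordinal hj)) // (e3 (Ordinal hk)) // in jk *; rewrite coll.
rewrite (e2 (Ordinal hi)) // (e3 (Ordinal hk)) // in ik *.
by rewrite (e1 (Ordinal hj)) // (e3 (Ordinal hk)) // in jk *; rewrite coll ?orbT.
Qed.

Lemma dag_on_collider (W : {set 'I_3}) G : dag_on W G ->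
  (X1, X3) \in G -> (X2, X3) \in G -> (X1, X2) \notin G -> G = collider.
Proof.
move=> dag g13 g23 g12; apply/setP => -[i j]; rewrite in_set2 !xpair_eqE.
apply/idP/orP => [gij|[] /andP [/eqP-> /eqP->] //].
have [_ _ ltij] := dag _ _ gij.
case: i j => [[|[|[|i]]] hi] [[|[|[|j]]] hj] // in gij ltij *.
- case/negP: g12; suff [-> ->] : X1 = Ordinal hi /\ X2 = Ordinal hj by [].
  by split; apply: val_inj.
- by left.
- by right.
Qed.

Lemma adjacent_collider a b : adjacent collider a b -> (a == X3) (+) (b == X3).
Proof.
by rewrite /adjacent !in_set2 !xpair_eqE => /orP [] /orP [] /andP [/eqP-> /eqP->].
Qed.

Lemma dseparated_collider : dseparated collider [set X1] [set X2] set0.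
Proof.
move=> a s /set1P->; rewrite in_set1.
case: s => [//|x [|y [|z s]]] /=; rewrite ?andbT.
- by move=> /eqP-> /adjacent_collider.
- move=> /eqP-> /andP [/adjacent_collider/= /eqP -> _] _.
  exists nil, nil, X1, X3, X2; split=> //; rewrite !inE /=.
  by move=> l _; rewrite in_set0.
(* Paths alternate between [X3] and the other two vertices, so a longer one would visit [X3]
   twice. *)
- move=> _ /and4P [/adjacent_collider/= /eqP-> /adjacent_collider/=].
  move=> /negPf y3 /adjacent_collider.
  by rewrite y3 /= => /eqP->; rewrite !inE eqxx !(orbT, andbF).
Qed.

(** [X3] is adjacent to both other vertices, so it lies on neither side of a d-separation;
    conditioning on it opens the path through it. Up to symmetry only the hypothesis remains. *)
Lemma Imap_collider : CSI theta [set X2] [set X1] set0 empty_outcome ->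
  Imap theta empty_outcome collider.
Proof.
move=> csi A B S _ _ _ AB AS BS A0 B0 sep.
split; rewrite ?dom_empty_outcome ?setC0 ?subsetT //.
have not3 A' B' : [disjoint A' & B'] -> B' != set0 ->
    (forall a b, a \in A' -> b \in B' -> a != b -> ~~ adjacent collider a b) ->
    X3 \notin A'.
  move=> AB' B0' sep'; apply/negP => A3; have [b bB] := set0Pn _ B0'.
  have b3 : X3 != b by apply: contraTneq bB => <-; rewrite (disjointFr AB').
  have := sep' _ _ A3 bB b3; rewrite eq_sym in b3.
  case/or3P: (@ord3_cases X1 X2 b isT isT isT) => /eqP eb; rewrite eb // in b3 *;
  by rewrite /adjacent !in_set2 !xpair_eqE.
have A3 : X3 \notin A.
  by apply: not3 AB B0 _ => a b aA bB; apply: dseparated_nonadjacent sep aA bB.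
have B3 : X3 \notin B.
  rewrite disjoint_sym in AB; apply: not3 AB A0 _ => b a bB aA ba.
  by have := dseparated_nonadjacent sep aA bB; rewrite eq_sym /adjacent orbC => ->.
have set1_of A' B' i j : i != j -> i != X3 -> j != X3 -> [disjoint A' & B'] ->
    X3 \notin A' -> i \in A' -> j \in B' -> A' = [set i].
  move=> ij i3 j3 AB' A3' iA jB; apply/setP=> l; rewrite in_set1.
  case/or3P: (ord3_cases l ij i3 j3) => /eqP->; rewrite ?eqxx //.
    by rewrite eq_sym (negPf ij); apply/negbTE; rewrite (disjointFl AB').
  by rewrite (negPf A3') eq_sym (negPf i3).
have S3 i j : i != j -> i != X3 -> j != X3 -> i \in A -> j \in B -> X3 \notin S.
  move=> ij i3 j3 iA jB; apply/negP => S3.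
  have [] := sep i [:: X3; j] iA jB.
  - by rewrite /= /adjacent !collider_edge ?orbT.
  - by rewrite /= !inE negb_or i3 ij eq_sym j3.
  move=> s1 [s2 [a [m [b []]]]].
  case: s1 => [|? [|? [|? [|? ?]]]] //= [<- <- <- _]; rewrite !collider_edge //=.
  by move=> /(_ X3 (connect0 _ _)); rewrite S3.
have [a aA] := set0Pn _ A0; have [b bB] := set0Pn _ B0.
have ab : a != b by apply: contraTneq bB => <-; rewrite (disjointFr AB).
have a3 : a != X3 by apply: contraNneq A3 => <-.
have b3 : b != X3 by apply: contraNneq B3 => <-.
have eA : A = [set a] by apply: set1_of aA bB.
have eB : B = [set b].
  by apply: (set1_of _ A) aA => //; rewrite 1?eq_sym // disjoint_sym.
have -> : S = set0.
  apply/setP=> l; rewrite in_set0; case/or3P: (ord3_cases l ab a3 b3) => /eqP->.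
  - by rewrite (disjointFr AS).
  - by rewrite (disjointFr BS).
  - by apply/negbTE/(S3 a b).
rewrite eA eB.
case/or3P: (@ord3_cases X1 X2 a isT isT isT) => /eqP ea; rewrite ea // in ab a3 *;
case/or3P: (@ord3_cases X1 X2 b isT isT isT) => /eqP eb; rewrite eb // in ab b3 *.
exact: CSI_symmetry.
Qed.

(** Removing the edge from [i] to [X3] isolates [i], so [i] and [X3] would have to be separated
    given [j] in the empty context. This contradicts [CSI_singleton_stage], which demands a context
    value for [j]. *)
Lemma minimal_context_dag_collider v : v \in level X3 -> singleton_stage v ->
  CSI theta [set X2] [set X1] set0 empty_outcome ->
  minimal_context_dag theta empty_outcome collider.
Proof.
move=> vl vsing csi; split.
- move=> i j; rewrite in_set2 !xpair_eqE dom_empty_outcome setC0 !in_setT.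
  by case/orP=> /andP [/eqP-> /eqP->].
- exact: Imap_collider.
have key i j : i != j -> i != X3 -> j != X3 ->
    ~ Imap theta empty_outcome (collider :\ (i, X3)).
  move=> ij i3 j3; rewrite (collider_remove ij) // /Imap dom_empty_outcome setC0 => imap.
  have [|||||||||_ _ _ cij] := imap [set i] [set X3] [set j];
    rewrite ?subsetT ?disjoints1 ?in_set1 //.
  - by rewrite eq_sym.
  - by apply/set0Pn; exists i; rewrite set11.
  - by apply/set0Pn; exists X3; rewrite set11.
  - move=> a [|x s] /set1P->; rewrite in_set1 /=; first by rewrite (negPf i3).
    by rewrite /adjacent !in_set1 !xpair_eqE (negPf ij) (negPf i3) andbF.
  have [] := CSI_singleton_stage vl vsing cij ij i3 j3.
    by rewrite /separates !set11.
  by rewrite empty_outcomeE.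
by move=> e /set2P [] ->; [apply: (key _ X2) | apply: (key _ X1)].
Qed.

(** Minimality is vacuous, as the empty context has no nonempty subset to absorb. *)
Lemma minimal_context_empty A B S : A != set0 -> B != set0 ->
  CSI theta A B S empty_outcome -> minimal_context theta empty_outcome.
Proof.
move=> A0 B0 csi; exists A, B, S; split=> // T T0.
by rewrite dom_empty_outcome subset0 (negPf T0).
Qed.

End ThreeVariables.

(** * Interpolating polynomials and balancedness *)

Section InterpolatingPolynomials.
Context {p : nat} {d : 'I_p -> nat} {L : finType}.
Variables (R : realType) (theta : outcome d * outcome d -> L).
Implicit Types (v w : outcome d) (k : 'I_p).

Lemma tpoly_leaf v : dom v = setT -> tpoly theta R v = 1.
Proof.
move=> vT; rewrite /tpoly vT setCT.
have -> : outcomes set0 = [set empty_outcome] :> {set outcome d}.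
  apply/setP=> z; rewrite in_set1 outcomesE; apply/eqP/eqP => [/dom0P //|->].
  exact: dom_empty_outcome.
by rewrite big_set1 combine_emptyr path_edges_self big_set0.
Qed.

Lemma tpoly_last v k : k.+1 = p -> v \in level k ->
  tpoly theta R v = \sum_(a : 'I_(d k)) 'X_(enum_rank (theta (v, extend v a))).
Proof.
move=> kp vk; rewrite /tpoly.
have dv : ~: dom v = [set k].
  apply/setP=> i; rewrite in_setC (level_dom vk) in_initial in_set1 -leqNgt.
  by rewrite -(inj_eq val_inj) /= eqn_leq -[(i <= k)%N]ltnS kp ltn_ord.
have -> : outcomes (~: dom v) = [set extend empty_outcome a | a : 'I_(d k)].
  apply/setP=> z; rewrite outcomesE dv; apply/eqP/imsetP => [zk|[a _ ->]]; last first.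
    by rewrite dom_extend dom_empty_outcome setU0.
  have : isSome (z k) by rewrite -in_dom zk set11.
  case E: (z k) => [a|] // _; exists a => //; apply/outcomeP => i.
  have [->|ik] := eqVneq i k; first by rewrite extend_in.
  by rewrite extend_out // empty_outcomeE notin_dom // zk in_set1.
rewrite big_imset => [|a b _ _ eab] /=; last first.
  by have := extend_in empty_outcome b; rewrite -eab extend_in => -[].
apply: eq_big => // a _; have -> : combine v (extend empty_outcome a) = extend v a.
  apply/outcomeP => i; rewrite combineE; have [->|ik] := eqVneq i k.
    by rewrite !extend_in notin_dom // (level_dom vk) in_initial ltnn.
  by rewrite !extend_out // empty_outcomeE; case: (v i).
by rewrite path_edges_extend // big_set1.
Qed.

(** On the last nonleaf level the polynomials are sums of single labels, which condition (2) matches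
    term by term. *)
Lemma tpoly_same_stage v w k : cstree theta -> k.+1 = p ->
  v \in level k -> w \in level k -> same_stage theta v w ->
  tpoly theta R v = tpoly theta R w.
Proof.
case=> _ _ eqth _ kp vk wk vw; rewrite !(@tpoly_last _ k) //.
by apply: eq_bigr => a _; rewrite (eqth k v w).
Qed.

Definition avoids (A : {set L}) : 'I_#|L| -> R := fun l => (enum_val l \notin A)%:R.

Lemma tpoly_avoids0 v k : k.+1 = p -> v \in level k ->
  (tpoly theta R v).@[avoids (labels theta v)] = 0.
Proof.
move=> kp vk; rewrite (tpoly_last kp) // raddf_sum big1 // => a _ /=.
rewrite mevalXU /avoids enum_rankK; case: (boolP (_ \in _)) => // /negP[].
by apply/imsetP; exists (extend v a) => //; rewrite inE level_edge.
Qed.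

(** Different stages have disjoint label sets, so every label of [w] evaluates to 1 and the sum is
    [d k], nonzero in characteristic 0. *)
Lemma tpoly_avoids_neq0 v w k : cstree theta -> k.+1 = p -> (0 < d k)%N ->
  v \in level k -> w \in level k ->
  ~~ same_stage theta v w -> (tpoly theta R w).@[avoids (labels theta v)] != 0.
Proof.
move=> [[_ disj] _ _ _] kp dk vk wk; rewrite (same_stageE _ vk wk) => vw.
have dvw : [disjoint labels theta v & labels theta w].
  by case: (disj v w (level_vertex vk) (level_vertex wk)) => // e; rewrite e eqxx in vw.
rewrite (tpoly_last kp) // raddf_sum (eq_bigr (fun=> 1)) => [|a _].
  by rewrite sumr_const card_ord pnatr_eq0 -lt0n.
rewrite /= mevalXU /avoids enum_rankK (disjointFl dvw) //.
by apply/imsetP; exists (extend w a) => //; rewrite inE level_edge.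
Qed.

End InterpolatingPolynomials.

(** * The two implications *)

Section Main.
Context {d : 'I_3 -> nat} {L : finType}.
Variables (R : realType) (theta : outcome d * outcome d -> L).
Hypothesis theta_cstree : cstree theta.
Hypothesis d_ge2 : forall i, (2 <= d i)%N.
Implicit Types (x v w u c : outcome d).

Local Notation X1 := (ord0 : 'I_3).
Local Notation X2 := (Ordinal (isT : 1 < 3)%N).
Local Notation X3 := (ord_max : 'I_3).

(** Write [u] as [extend v0 s] and apply the identity to [v0], another level-1 vertex [w0] and
    another value [r]. Only the left side contains the polynomial of [u], so evaluation makes it
    alone vanish. *)
Lemma balanced_no_singleton v w : balanced theta R ->
  v \in level X2 -> w \in level X2 -> same_stage theta v w -> v != w ->
  forall u, u \in level X3 -> ~ singleton_stage theta u.
Proof.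
move=> bal vl wl vw ne u ul usg.
have lt23 : (X2 <= X3)%N by [].
set v0 := restr u (initial X2).
have v0l : v0 \in level X2 by apply: level_restr lt23.
(* Two distinct vertices in one stage force level 1 to be a single stage. *)
have all_same w1 w2 : w1 \in level X2 -> w2 \in level X2 -> same_stage theta w1 w2.
  move=> l1 l2; rewrite -(same_stage_trans vl l1 l2);
    exact: same_stage_X2 vl wl vw ne _ _.
have [b bu] := exists_other_value (u X1) (d_ge2 X1).
have [r ru] := exists_other_value (u X2) (d_ge2 X2).
set w0 := extend v0 b; have w0l : w0 \in level X2 by apply: level_update.
have : isSome (u X2) by rewrite -in_dom (level_dom ul) in_initial.
case E: (u X2) => [s|] // _.
have eu : u = extend v0 s.
  apply: (@level_X3_eq _ X1 X2) => //.
  - exact: (@level_extend _ _ _ X2).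
  - by rewrite extend_out // restrE initial_X2 set11.
  - by rewrite extend_in.
have ne_u x : x \in level X3 -> x <> u ->
    (tpoly theta R x).@[avoids R (labels theta u)] != 0.
  move=> xl xu; apply: (@tpoly_avoids_neq0 _ _ _ _ _ _ _ X3) => //; first exact: ltnW.
  by apply/negP => /(usg _ xl).
have lvl3 x (a : 'I_(d X2)) : x \in level X2 -> extend x a \in level X3.
  exact: (@level_extend _ _ _ X2).
have := bal X2 v0 w0 v0l w0l (all_same _ _ v0l w0l) s r.
move/(congr1 (meval (avoids R (labels theta u)))); rewrite !mevalM -eu.
rewrite (@tpoly_avoids0 _ _ _ _ _ _ X3) // mul0r => /esym/eqP.
rewrite mulf_eq0 => /orP []; apply/negP; apply: ne_u; try exact: lvl3.
  by move=> e; move: ru; rewrite -e extend_in eqxx.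
by move=> e; move: bu; rewrite -e extend_out // extend_in eqxx.
Qed.

(** An imperfect DAG is the collider, whose d-separation of 1 and 2 forces a nontrivial level-1
    stage. Balancedness then excludes singleton stages, one of X_1, X_2 can be isolated, and the
    collider is not minimal. *)
Lemma balanced_perfect : balanced theta R ->
  forall c G, minimal_context_dag theta c G -> perfect G.
Proof.
move=> bal c G [dag imap minG]; apply: (dag_on_perfect dag) => g13 g23.
apply: contraT => g12; have eG := dag_on_collider dag g13 g23 g12.
have mem e : e \in G -> e.1 \notin dom c /\ e.2 \notin dom c.
  by case: e => a b /dag [] /=; rewrite !in_setC.
(* The collider uses all three variables, so none is left for the context. *)
have c0 : c = empty_outcome.
  apply/outcomeP => l; rewrite empty_outcomeE notin_dom //.
  case/or3P: (@ord3_cases X1 X2 l isT isT isT) => /eqP->.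
  - exact: (mem _ g13).1.
  - exact: (mem _ g23).1.
  - exact: (mem _ g13).2.
rewrite {}c0 {}eG in imap minG *.
have [|||||||||_ _ _ c12] := imap [set X1] [set X2] set0;
  rewrite ?dom_empty_outcome ?setC0 ?subsetT ?disjoints1 ?in_set0 ?in_set1 //.
- by apply/set0Pn; exists X1; rewrite set11.
- by apply/set0Pn; exists X2; rewrite set11.
- exact: dseparated_collider.
have [|v [w [vl wl vw ne]]] := CSI_separates12 d_ge2 c12.
  by rewrite /separates !set11.
have iso i j : i != j -> i != X3 -> j != X3 ->
    (forall v, v \in level X3 -> stage_free theta j v) ->
    CSI theta [set j] [set i] set0 empty_outcome -> false.
  move=> ij i3 j3 fr ji; case: (minG _ (collider_edge j3)).
  rewrite (collider_remove (i := j) (j := i)) // 1?eq_sym //.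
  by apply: (Imap_isolated ij) => //; apply: CSI_isolated.
have nosing := balanced_no_singleton bal vl wl vw ne.
have [fr|fr] := all_stage_free theta_cstree d_ge2 nosing.
  by apply: (iso X1 X2) => //; apply: CSI_symmetry.
exact: (iso X2 X1).
Qed.

(** The root level has one vertex and the children of level 2 are leaves with polynomial 1, so only
    level 1 matters. There a singleton stage would make the collider a minimal context DAG. *)
Lemma perfect_balanced :
  (forall c, minimal_context theta c ->
    forall G, minimal_context_dag theta c G -> perfect G) ->
  balanced theta R.
Proof.
move=> perf k v w vk wk vw s r.
case/or3P: (@ord3_cases X1 X2 k isT isT isT) => /eqP ek; subst k.
- have root u : u \in level X1 -> u = empty_outcome.
    move=> /level_dom ul; apply: dom0P; rewrite ul.
    by apply/setP=> i; rewrite !inE.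
  by rewrite (root v vk) (root w wk); apply: mulrC.
- have [->|ne] := eqVneq v w; first exact: mulrC.
  have csi := CSI_independent12 theta_cstree d_ge2 vk wk vw ne.
  have nosing u : u \in level X3 -> ~ singleton_stage theta u.
    move=> ul usg; have := minimal_context_dag_collider theta_cstree d_ge2 ul usg csi.
    have ctx : minimal_context theta empty_outcome.
      apply: minimal_context_empty csi; apply/set0Pn; [exists X2|exists X1];
      by rewrite set11.
    move/(perf _ ctx) => /(_ X1 X2 X3); rewrite !collider_edge // => /(_ isT isT isT).
    by rewrite /adjacent !in_set2 !xpair_eqE.
  have lvl3 x (a : 'I_(d X2)) : x \in level X2 -> extend x a \in level X3.
    exact: (@level_extend _ _ _ X2).
  have teq u u' : u \in level X3 -> u' \in level X3 -> same_stage theta u u' ->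
      tpoly theta R u = tpoly theta R u'.
    by move=> ul ul' uu; apply: (@tpoly_same_stage _ _ _ _ _ _ _ X3).
  have [fr|fr] := all_stage_free theta_cstree d_ge2 nosing.
    (* Stages free in X_2: the polynomials do not depend on the chosen value, so both sides
       coincide. *)
    have row x : x \in level X2 ->
        tpoly theta R (extend x s) = tpoly theta R (extend x r).
      move=> xl; apply: teq; try exact: lvl3.
      have -> : extend x r = extend (extend x s) r.
        apply/outcomeP => i; have [->|i2] := eqVneq i X2; first by rewrite !extend_in.
        by rewrite !extend_out.
      exact: (forallP (fr _ (lvl3 _ _ xl))).
    by rewrite !row.
  (* Stages free in X_1: [v] and [w] are interchangeable, and commutativity suffices. *)
  have col (a : 'I_(d X2)) : tpoly theta R (extend v a) = tpoly theta R (extend w a).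
    apply: teq; try exact: lvl3.
    have : isSome (w X1) by rewrite -in_dom (level_dom wk) in_initial.
    case E: (w X1) => [b|] // _.
    have -> : extend w a = extend (extend v a) b.
      apply: (@level_X3_eq _ X1 X2) => //.
      - exact: lvl3.
      - by apply: level_update => //; apply: lvl3.
      - by rewrite extend_in extend_out.
      - by rewrite extend_in extend_out // extend_in.
    exact: (forallP (fr _ (lvl3 _ _ vk))).
  by rewrite !col mulrC.
- have leaf x (a : 'I_(d X3)) : x \in level X3 -> tpoly theta R (extend x a) = 1.
    move=> xl; apply: tpoly_leaf; rewrite (level_dom (level_extend a xl)).
    by apply/setP=> i; rewrite in_initial in_setT ltn_ord.
  by rewrite !leaf.
Qed.

End Main.

Theorem theorem3p2 (R : realType) (d : 'I_3 -> nat) (L : finType)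
    (theta : outcome d * outcome d -> L)
    (d_ge2 : forall i : 'I_3, (2 <= d i)%N)
    (theta_cstree : cstree theta) :
  balanced theta R <->
  (forall c : outcome d, minimal_context theta c ->
     forall G : {set 'I_3 * 'I_3}, minimal_context_dag theta c G -> perfect G).
Proof.
split; last exact: perfect_balanced.
by move=> bal c _ G; apply: balanced_perfect bal c G.
Qed.
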